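(* Let $m\ge 2$ and let $A\in \mathrm{Mat}_{m-1}(\mathbb{Z})$ be a matrix with $A^m=I$ and $\det(A-I)\neq 0$. Let $G=\mathbb{Z}^{m-1}\rtimes_A \mathbb{Z}/m\mathbb{Z}$, where the action of $\mathbb{Z}/m\mathbb{Z}$ on $\mathbb{Z}^{m-1}$ is given by powers of $A$, and let $R_n$ be a (lazy) random walk on $G$. Then $G$ satisfies $x^m=1$ with probability at least $\frac{\phi(m)}{m}$ with respect to the random walk $R_n$, i.e. $$\limsup_{n\to\infty}\Pr(R_n^m=1)\ge\frac{\phi(m)}{m},$$ where $\phi$ is Euler's totient function, but $G$ does not satisfy $x^m=1$ virtually.
   Context: A (lazy) random walk on $G$ is $R_0=1$, $R_{n+1}=R_nx_n$ with $x_i$ i.i.d. of law $\mu$, where $\mu$ is a finitely supported probability measure on $G$ whose support generates $G$ and with $\mu(1)>0$. A group satisfies a law virtually if it has a finite index subgroup satisfying the law. *)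

(* Defs.v *)
From HB Require Import structures.
From mathcomp Require Import all_boot all_order all_algebra finmap.
From mathcomp Require Import all_classical all_reals all_analysis.

Set Implicit Arguments.
Unset Strict Implicit.
Unset Printing Implicit Defensive.

Import Order.TTheory GRing.Theory Num.Theory.

Local Open Scope classical_set_scope.
Local Open Scope ring_scope.

(* The semidirect product Z^n ><|_A Z/m, where k in Z/m acts on Z^n by A^k.
   'Z_m is Z/m only for 1 < m, and k |-> A^k is well defined on Z/m only if
   A^m = 1, so both proofs are parameters of the type. *)
Definition semidirect (n m : nat) (A : 'M[int]_n)
    (m_gt1 : (1 < m)%N) (Am1 : A ^+ m = 1%:M) : Type :=
  ('cV[int]_n * 'Z_m)%type.

Section Semidirect.
Variables (n m : nat) (A : 'M[int]_n).
Hypotheses (m_gt1 : (1 < m)%N) (Am1 : A ^+ m = 1%:M).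

Local Notation G := (semidirect m_gt1 Am1).

HB.instance Definition _ := Choice.on G.

Definition sd_mul (x y : G) : G := (x.1 + A ^+ x.2 *m y.1, x.2 + y.2).
Definition sd_one : G := (0, 0).
Definition sd_inv (x : G) : G := (- (A ^+ (- x.2)%R *m x.1), - x.2).

Lemma sd_expD (k l : 'Z_m) : A ^+ (k + l)%R = A ^+ k *m A ^+ l.
Proof.
have Am1' : A ^+ (Zp_trunc m).+2 = 1 by rewrite Zp_cast.
by rewrite -[RHS]/(A ^+ k * A ^+ l) -exprD -(expr_mod (k + l) Am1').
Qed.

Lemma sd_mulA : associative sd_mul.
Proof.
move=> [u j] [v k] [w l]; congr pair => /=; last exact: addrA.
by rewrite sd_expD mulmxDr mulmxA addrA.
Qed.

Lemma sd_mul1g : left_id sd_one sd_mul.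
Proof. by move=> [u j]; rewrite /sd_mul /= add0r expr0 mul1mx add0r. Qed.

Lemma sd_mulg1 : right_id sd_one sd_mul.
Proof. by move=> [u j]; rewrite /sd_mul /= mulmx0 !addr0. Qed.

Lemma sd_mulVg : left_inverse sd_one sd_inv sd_mul.
Proof. by move=> [u j]; rewrite /sd_mul /sd_inv /= !addNr. Qed.

Lemma sd_mulgV : right_inverse sd_one sd_inv sd_mul.
Proof.
move=> x; congr pair; last exact: subrr.
rewrite -[LHS]/(x.1 + A ^+ x.2 *m - (A ^+ (- x.2)%R *m x.1)).
by rewrite mulmxN mulmxA -sd_expD subrr expr0 mul1mx subrr.
Qed.

HB.instance Definition _ :=
  isGroup.Build G sd_mulA sd_mul1g sd_mulg1 sd_mulVg sd_mulgV.

End Semidirect.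

Section Virtually.
Variable G : groupType.

Definition is_subgroup (H : set G) : Prop := group_closed [in H].

Definition finite_index (H : set G) : Prop :=
  finite_set [set [set (g * h)%g | h in H] | g in [set: G]].

Definition satisfies_power_law (m : nat) (H : set G) : Prop :=
  forall h, H h -> (h ^+ m = 1)%g.

Definition virtually (L : set G -> Prop) : Prop :=
  exists H : set G, [/\ is_subgroup H, finite_index H & L H].

Definition generates (S : set G) : Prop := smallest is_subgroup S = [set: G].

End Virtually.

(* G with the sigma-algebra of all its subsets. *)
Definition discr (G : groupType) : Type := G.

Section Discr.
Variable G : groupType.
HB.instance Definition _ := Group.on (discr G).
HB.instance Definition _ := isPointed.Build (discr G) 1%g.
HB.instance Definition _ := @isMeasurable.Build default_measure_display
  (discr G) discrete_measurable (@discrete_measurable0 _)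
  (@discrete_measurableC _) (@discrete_measurableU _).
End Discr.

Local Open Scope ereal_scope.

Section RandomWalk.
Variables (G : groupType) (R : realType).

Definition msupport (mu : probability (discr G) R) : set G :=
  [set g | mu [set g] != 0].

(* The equation mu (msupport mu) = 1 follows from finiteness of the support
   when G is countable; it rules out diffuse measures on uncountable G. *)
Definition finitely_supported (mu : probability (discr G) R) : Prop :=
  finite_set (msupport mu) /\ mu (msupport mu) = 1.

Definition lazy_step (mu : probability (discr G) R) : Prop :=
  [/\ finitely_supported mu, generates (msupport mu) & 0 < mu [set 1%g]].

Variables (d : measure_display) (Omega : measurableType d).
Variable P : probability Omega R.

Definition mutually_independent (X : nat -> {RV P >-> discr G}) : Prop :=
  forall (J : {fset nat}) (B : nat -> set (discr G)),
    (forall j, measurable (B j)) ->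
    P (\bigcap_(j in [set` J]) (X j @^-1` B j)) =
    \prod_(j <- J) P (X j @^-1` B j).

Definition iid_of_law (mu : probability (discr G) R)
    (X : nat -> {RV P >-> discr G}) : Prop :=
  mutually_independent X /\
  forall (i : nat) (B : set (discr G)),
    measurable B -> distribution P (X i) B = mu B.

Fixpoint walk (X : nat -> {RV P >-> discr G}) (n : nat) (w : Omega) : G :=
  if n is k.+1 then (walk X k w * (X k w : G))%g else 1%g.

End RandomWalk.

(* Main.v *)
Require Import Defs.
From HB Require Import structures.
From mathcomp Require Import all_boot all_order all_algebra finmap.
From mathcomp Require Import all_classical all_reals all_analysis.
From mathcomp Require Import ring lra.

(** The second coordinate maps the semidirect product onto Z/m, and it decides
    almost everything. Take g = (v, k) with k coprime to m. The second
    coordinate of g ^+ m is m k = 0, so g ^+ m is a translation (w, 0). As a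
    power of g it commutes with g, which says that A ^+ k fixes w. Some power
    of A ^+ k is A because k is invertible modulo m and A ^+ m = 1, so A
    fixes w; since A - 1 has a nonzero determinant, w = 0
    ([sd_expg_coprime]). Hence R_n ^+ m = 1 as soon as the projection of R_n
    to Z/m is one of the phi(m) units.

    The projection of R_n is a lazy random walk on a finite group whose steps
    generate it, so it equidistributes ([limsup_walk_ge]). The proof is
    Doeblin's: laziness and generation make some N-step law everywhere at
    least e > 0 ([walk_law_full_support]), and each further N steps then
    multiply the deficit of the smallest mass relative to 1 / #|K| by at most
    1 - #|K| e ([walk_law_lower]).

    No finite-index subgroup has exponent m because m - 1 > 0: the translations
    by multiples of one nonzero vector have infinite order, and two distinct
    ones must fall in the same coset ([not_virtually_power_law]). *)

Set Implicit Arguments.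
Unset Strict Implicit.
Unset Printing Implicit Defensive.

Import Order.TTheory GRing.Theory Num.Theory.

Local Open Scope classical_set_scope.
Local Open Scope ring_scope.

(** * Convolution powers on a finite abelian group *)

Section FiniteWalk.
Variables (R : realType) (K : finZmodType) (nu : K -> R).
Hypotheses (nu_ge0 : forall k, 0 <= nu k) (nu_sum1 : \sum_k nu k = 1).

Definition conv_step (q : K -> R) (k : K) : R := \sum_l q (k - l) * nu l.

Definition walk_law (n : nat) : K -> R :=
  iter n conv_step (fun k => (k == 0)%:R).

Lemma conv_step_ge0 q : (forall k, 0 <= q k) -> forall k, 0 <= conv_step q k.
Proof. by move=> q_ge0 k; apply: sumr_ge0 => l _; apply: mulr_ge0. Qed.

Lemma sum_conv_step q : \sum_k conv_step q k = \sum_k q k.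
Proof.
rewrite /conv_step exchange_big /= -[RHS]mulr1 -nu_sum1 mulr_sumr.
apply: eq_bigr => l _; rewrite mulr_suml [RHS](reindex_inj (addIr (- l))) /=.
by [].
Qed.

Lemma walk_law_ge0 n k : 0 <= walk_law n k.
Proof.
elim: n k => [|n IH] k; first exact: ler0n.
exact: conv_step_ge0.
Qed.

Lemma sum_walk_law n : \sum_k walk_law n k = 1.
Proof.
elim: n => [|n IH]; last by rewrite [LHS]sum_conv_step.
by rewrite (bigD1 0) //= eqxx big1 ?addr0 // => k /negPf ->.
Qed.

Lemma iter_conv_step n q k :
  iter n conv_step q k = \sum_l q l * walk_law n (k - l).
Proof.
elim: n k => [|n IH] k.
  rewrite (bigD1 k) //= subrr eqxx mulr1 big1 ?addr0 // => l.
  by rewrite /walk_law /= subr_eq0 eq_sym => /negPf ->; rewrite mulr0.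
transitivity (\sum_j \sum_l q l * walk_law n (k - j - l) * nu j).
  rewrite iterS -[LHS]/(\sum_j iter n conv_step q (k - j) * nu j).
  by apply: eq_bigr => j _; rewrite IH mulr_suml.
rewrite exchange_big; apply: eq_bigr => l _.
rewrite -[walk_law n.+1 _]/(\sum_j walk_law n (k - l - j) * nu j) mulr_sumr.
by apply: eq_bigr => j _; rewrite mulrA addrAC.
Qed.

(** Doeblin's contraction. In [\sum_l q l * walk_law N (k - l)], split
    [q l = c + (q l - c)]: the constant part contributes exactly [c], and the
    nonnegative part has total mass [1 - #|K| c], of which at least the
    fraction [e] lands on [k]. *)
Lemma iter_conv_step_lower N (e c : R) q :
    (forall k, e <= walk_law N k) -> \sum_k q k = 1 ->
    (forall k, c <= q k) ->
  forall k, e + (1 - #|K|%:R * e) * c <= iter N conv_step q k.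
Proof.
move=> e_le q1 c_le k; rewrite iter_conv_step.
have -> : \sum_l q l * walk_law N (k - l)
  = \sum_l (q l - c) * walk_law N (k - l) + c.
  under [in RHS]eq_bigr do rewrite mulrBl.
  rewrite sumrB -mulr_sumr.
  have <- : \sum_l walk_law N l = \sum_l walk_law N (k - l).
    by rewrite (reindex_inj (subrI k)).
  by rewrite sum_walk_law mulr1 subrK.
have : e * \sum_l (q l - c) <= \sum_l (q l - c) * walk_law N (k - l).
  rewrite mulr_sumr; apply: ler_sum => l _.
  by rewrite mulrC; apply: ler_wpM2l; rewrite ?subr_ge0.
rewrite sumrB q1 sumr_const -[c *+ _]mulr_natl => le_e.
apply: le_trans (lerD le_e (lexx c)).
by rewrite le_eqVlt; apply/predU1l; ring.
Qed.

(** Iterating the contraction: the affine map [c |-> e + (1 - #|K| e) c] has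
    the uniform mass [1 / #|K|] as its fixed point. *)
Lemma walk_law_lower N (e : R) : (forall k, e <= walk_law N k) ->
  forall j k, (1 - (1 - #|K|%:R * e) ^+ j) / #|K|%:R <= walk_law (j * N) k.
Proof.
move=> e_le; have K_neq0 : #|K|%:R != 0 :> R.
  by rewrite pnatr_eq0 -lt0n; apply/card_gt0P; exists 0.
elim=> [|j IH] k; first by rewrite expr0 subrr mul0r walk_law_ge0.
have := iter_conv_step_lower e_le (sum_walk_law (j * N)) IH k.
rewrite mulSn /walk_law iterD; apply: le_trans; rewrite exprS.
by rewrite le_eqVlt; apply/predU1l; field.
Qed.

Hypothesis nu0_gt0 : 0 < nu 0.
(** A set of elements that contains 0 and is closed under subtraction is a
    subgroup, so this says that the steps of positive mass generate [K]. *)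
Hypothesis nu_gen : forall H : {set K},
  (forall k l, k \in H -> l \in H -> k - l \in H) ->
  (forall k, 0 < nu k -> k \in H) -> forall k, k \in H.

Lemma walk_law_step_gt0 n k s :
  0 < walk_law n k -> 0 < nu s -> 0 < walk_law n.+1 (k + s).
Proof.
move=> k_gt0 s_gt0.
rewrite -[walk_law n.+1 _]/(\sum_l walk_law n (k + s - l) * nu l).
rewrite (bigD1 s) //= addrK.
apply: ltr_wpDr; last exact: mulr_gt0.
by apply: sumr_ge0 => l _; rewrite mulr_ge0 // walk_law_ge0.
Qed.

(** Laziness lets the walk wait where it is, so reachable points stay
    reachable at all later times. *)
Lemma walk_law_mono_gt0 n p k :
  (n <= p)%N -> 0 < walk_law n k -> 0 < walk_law p k.
Proof.
move=> /subnK <-; elim: (p - n)%N => // j IH k_gt0.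
by rewrite addSn -[k]addr0; apply: walk_law_step_gt0 => //; apply: IH.
Qed.

(** The set [H] of points reachable at some time contains its translate by
    every step [s] of positive mass, hence equals it by finiteness. So these
    steps lie in the subgroup [S] of translations preserving [H]; as they
    generate, [S] is everything and [H], which contains 0, is [K]. *)
Lemma walk_law_full_support : exists N, forall k, 0 < walk_law N k.
Proof.
pose H : {set K} := [set k | `[< exists n, 0 < walk_law n k >]]%SET.
have memH k : k \in H <-> exists n, 0 < walk_law n k.
  by rewrite finset.in_set; split=> [/asboolP|nP] //; apply/asboolP.
have H0 : 0 \in H.
  by apply/memH; exists 0%N; rewrite /walk_law /= eqxx ltr01.
pose S : {set K} := [set s | +%R s @: H == H]%SET.
have S_stab s k : s \in S -> (s + k \in H) = (k \in H).
  by rewrite inE => /eqP sH; rewrite -{1}sH (mem_imset _ _ (addrI s)).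
have S_intro s : (forall k, k \in H -> s + k \in H) -> s \in S.
  move=> sH; rewrite inE eqEcard card_imset ?leqnn ?andbT; last exact: addrI.
  by apply/fintype.subsetP => _ /imsetP[k kH ->]; exact: sH.
have HT k : k \in H.
  suff kS : k \in S by rewrite -[k]addr0 S_stab.
  move: k; apply: nu_gen => [k l kS lS|s s_gt0].
    by apply: S_intro => j jH; rewrite -addrA S_stab // -(S_stab l) // addNKr.
  apply: S_intro => k /memH[n k_gt0]; apply/memH.
  by exists n.+1; rewrite addrC; exact: walk_law_step_gt0.
have /choice[t t_gt0] k : exists n, 0 < walk_law n k.
  exact/memH.
exists (\max_k t k)%N => k.
exact: walk_law_mono_gt0 (leq_bigmax k) (t_gt0 k).
Qed.

Lemma walk_law_equidistributed (n0 : nat) (e : R) : 0 < e ->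
  exists2 n, (n0 <= n)%N & forall k, #|K|%:R^-1 - e <= walk_law n k.
Proof.
move=> e_gt0; have [N N_gt0] := walk_law_full_support.
(* [N.+1] rather than [N]: the full support may already occur at time 0, and
   multiples of the period have to tend to infinity. *)
have {}N_gt0 k : 0 < walk_law N.+1 k by exact: walk_law_mono_gt0 (N_gt0 k).
pose k0 := [arg min_(k < 0) walk_law N.+1 k]%O.
have eps_le k : walk_law N.+1 k0 <= walk_law N.+1 k.
  by rewrite /k0; case: arg_minP => // i _; apply.
set eps := walk_law N.+1 k0 in eps_le.
have K_gt0 : 0 < #|K|%:R :> R by rewrite ltr0n; apply/card_gt0P; exists 0.
have Keps_gt0 : 0 < #|K|%:R * eps by rewrite mulr_gt0 // N_gt0.
have Keps_le1 : #|K|%:R * eps <= 1.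
  rewrite -[leRHS](sum_walk_law N.+1) mulr_natl -sumr_const.
  exact: ler_sum.
have delta_lt1 : `|1 - #|K|%:R * eps| < 1.
  by rewrite ltr_norml; apply/andP; split; lra.
have [j0 _ j0_lt] := (cvgrPdist_lt _ _).1 (cvg_geometric 1 delta_lt1) e e_gt0.
exists (maxn j0 n0 * N.+1)%N.
  by rewrite mulnS (leq_trans (leq_maxr j0 n0)) // leq_addr.
move=> k; apply: le_trans (walk_law_lower eps_le _ k).
have := j0_lt (maxn j0 n0) (leq_maxl _ _).
rewrite /= sub0r normrN mul1r; set d := _ ^+ _ => d_lt.
rewrite mulrBl mul1r lerD2l lerN2 ler_pdivrMr //.
apply: (le_trans (ler_norm d)); apply: (le_trans (ltW d_lt)).
rewrite ler_peMr ?(ltW e_gt0) // ler1n; by apply/card_gt0P; exists 0.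
Qed.
End FiniteWalk.

(** * Random walks projected to a finite abelian group *)

Lemma measure_fibres d (T : measurableType d) (R : realType)
    (mu : {measure set T -> \bar R}) (K : finType) (f : T -> K) (A : set T) :
    (forall k, measurable (A `&` f @^-1` [set k])) ->
  mu A = (\sum_(k : K) mu (A `&` f @^-1` [set k]))%E.
Proof.
move=> mAf; have AE : A = \bigcup_(k in [set: K]) (A `&` f @^-1` [set k]).
  by apply/seteqP; split=> [w Aw|w [k _ []]] //; exists (f w).
rewrite [in LHS]AE measure_fin_bigcup //; first last.
- exact: trivIset_preimage1_in.
- exact: finite_finset.
rewrite [RHS]fsbig_seq ?index_enum_uniq //.
congr (\big[_/_]_(i \in _) _).
by apply/seteqP; split=> k //= _; rewrite mem_index_enum.
Qed.

Section ProjectedWalk.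
Variables (G : groupType) (K : finZmodType) (proj : G -> K).
Hypothesis projM : forall x y : G, proj (x * y)%g = proj x + proj y.
Hypothesis proj_surj : forall k, exists g, proj g = k.

Variables (R : realType) (mu : probability (discr G) R).

Definition image_law (k : K) : R := fine (mu (proj @^-1` [set k])).

Lemma EFin_image_law k : (image_law k)%:E = mu (proj @^-1` [set k]).
Proof. by rewrite /image_law fineK // fin_num_measure. Qed.

Lemma image_law_ge0 k : 0 <= image_law k.
Proof. exact: fine_ge0. Qed.

Lemma sum_image_law : \sum_k image_law k = 1.
Proof.
apply: EFin_inj; rewrite -sumEFin.
transitivity (mu [set: discr G]); last exact: probability_setT.
rewrite (@measure_fibres _ _ _ mu _ (proj : discr G -> K)) //.
by apply: eq_bigr => k _; rewrite EFin_image_law setTI.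
Qed.

Lemma image_law_gt0 g : msupport mu g -> 0 < image_law (proj g).
Proof.
rewrite /msupport /= => g_neq0; rewrite -lte_fin EFin_image_law.
apply: (@lt_le_trans _ _ (mu [set g])).
  by rewrite lt0e g_neq0 measure_ge0.
by apply: le_measure; rewrite ?inE // => _ ->.
Qed.

Hypothesis mu_lazy : lazy_step mu.

Lemma proj1 : proj 1%g = 0.
Proof. by apply: (addrI (proj 1%g)); rewrite -projM mulg1 addr0. Qed.

Lemma projV g : proj (g^-1)%g = - proj g.
Proof. by apply/eqP; rewrite -addr_eq0 -projM mulVg proj1. Qed.

Lemma image_law0_gt0 : 0 < image_law 0.
Proof.
case: mu_lazy => _ _ mu1.
by rewrite -proj1 image_law_gt0 // /msupport /= gt_eqF.
Qed.

(** The preimage in [G] of a subgroup of [K] containing the projected support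
    is a subgroup containing the support of [mu], hence all of [G]. *)
Lemma image_law_generates (H : {set K}) :
  (forall k l, k \in H -> l \in H -> k - l \in H) ->
  (forall k, 0 < image_law k -> k \in H) -> forall k, k \in H.
Proof.
move=> HB H_supp k; have [g <-] := proj_surj k.
case: mu_lazy => _ mu_gen _; have : [set: G] g by [].
rewrite -mu_gen => /(_ [set h | proj h \in H]); apply; split; last first.
  by move=> h /image_law_gt0; exact: H_supp.
split=> [|h h']; rewrite !inE /=.
  by rewrite proj1; exact: H_supp image_law0_gt0.
by rewrite projM projV; exact: HB.
Qed.

Hypothesis G_countable : countable [set: G].
Variables (d : measure_display) (Omega : measurableType d).
Variables (P : probability Omega R) (x : nat -> {RV P >-> discr G}).
Hypothesis x_iid : iid_of_law mu x.

Lemma measurable_step i (C : set G) : measurable (x i @^-1` C).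
Proof. exact: (measurable_funPTI (x i)). Qed.

(** Countability of [G] is what makes a product of two measurable
    [G]-valued maps measurable for the discrete sigma-algebra. *)
Lemma measurable_walk n (C : set G) : measurable [set w | C (walk x n w)].
Proof.
elim: n C => [|n IH] C /=.
  have [C1|C1] := pselect (C 1%g).
    by rewrite (_ : mkset _ = setT) //; apply/seteqP; split.
  by rewrite (_ : mkset _ = set0) //; apply/seteqP; split.
rewrite (_ : mkset _ = \bigcup_(g : G)
  ([set w | [set g] (walk x n w)] `&` x n @^-1` [set h | C (g * h)%g])).
  apply: countable_bigcupT_measurable => // g.
  apply: measurableI; [exact: IH|exact: measurable_step].
apply/seteqP; split=> w /=; first by move=> Cw; exists (walk x n w).
by move=> [g _ [/= ->]].
Qed.

(** Independence of the position at time [n] from the steps at times [j >= n].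
    The extra events indexed by [J] make the induction on [n] go through: the
    step at time [n] is moved from the walk into [J]. *)
Lemma walk_law_joint n (J : {fset nat}) (B : nat -> set (discr G)) k :
    (forall j, j \in J -> (n <= j)%N) ->
  P ([set w | proj (walk x n w) = k]
     `&` \bigcap_(j in [set` J]) (x j @^-1` B j))
  = ((walk_law image_law n k)%:E * \prod_(j <- J) mu (B j))%E.
Proof.
elim: n J B k => [|n IH] J B k J_ge.
  have [x_ind x_law] := x_iid.
  have PJ : P (\bigcap_(j in [set` J]) (x j @^-1` B j))
    = (\prod_(j <- J) mu (B j))%E.
    by rewrite x_ind //; apply: eq_bigr => j _; exact: x_law.
  rewrite /walk_law /= proj1 eq_sym.
  have [->|k_neq] := eqVneq k 0.
    by rewrite mul1e -PJ; congr (P _); apply/seteqP; split=> w //= [].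
  rewrite mul0e -(measure0 P); congr (P _); apply/seteqP; split=> w //= [E].
  by rewrite -E eqxx in k_neq.
rewrite (@measure_fibres _ _ _ P _ (fun w => proj (x n w))); last first.
  move=> l; apply: measurableI; last first.
    exact: (measurable_step n (proj @^-1` [set l])).
  apply: measurableI; first exact: (measurable_walk n.+1 [set g | proj g = k]).
  apply: fin_bigcap_measurable => [|j _]; first exact: finite_fset.
  exact: measurable_step.
have nJ : n \notin J by apply/negP => /J_ge; rewrite ltnn.
transitivity (\sum_(l : K) (walk_law image_law n (k - l))%:E *
   ((image_law l)%:E * \prod_(j <- J) mu (B j)))%E.
  apply: eq_bigr => l _.
  pose Bl j := if j == n then proj @^-1` [set l] else B j.
  have -> : ((image_law l)%:E * \prod_(j <- J) mu (B j)
      = \prod_(j <- (n |` J)%fset) mu (Bl j))%E.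
    rewrite big_fsetU1 //= {1}/Bl eqxx EFin_image_law; congr (_ * _)%E.
    apply: eq_big_seq => j jJ; rewrite /Bl; case: eqP => // jn.
    by rewrite -jn jJ in nJ.
  rewrite -IH => [|j]; last by rewrite !inE => /orP[/eqP -> //|/J_ge/ltnW].
  congr (P _); apply/seteqP; split=> w /=.
    move=> [[wk wJ] wl]; split.
      by move: wk; rewrite projM wl => <-; rewrite addrK.
    move=> j /=; rewrite !inE /Bl; case: eqP => [->|_] //= jJ; exact: wJ.
  move=> [wk wJ].
  have wl : proj (x n w) = l.
    by have := wJ n; rewrite /= !inE eqxx /Bl eqxx /=; apply.
  split=> //; split; first by rewrite projM wk wl subrK.
  move=> j /= jJ; have := wJ j; rewrite /= !inE jJ orbT /Bl.
  by case: eqP => [jn|_]; [rewrite -jn jJ in nJ|apply].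
under eq_bigr do rewrite muleA -EFinM.
rewrite -ge0_sume_distrl => [|l _]; last first.
  by rewrite lee_fin mulr_ge0 ?walk_law_ge0 //; exact: image_law_ge0.
by rewrite sumEFin.
Qed.

Lemma proj_walk_law n k :
  P [set w | proj (walk x n w) = k] = (walk_law image_law n k)%:E.
Proof.
have := @walk_law_joint n fset0 (fun=> setT) k.
rewrite big_seq_fset0 mule1 => <- //.
by congr (P _); apply/seteqP; split=> w // [].
Qed.

Lemma proj_walk_equidistributed (n0 : nat) (e : R) : 0 < e ->
  exists2 n, (n0 <= n)%N &
    forall k, ((#|K|%:R^-1 - e)%:E <= P [set w | proj (walk x n w) = k])%E.
Proof.
move=> e_gt0.
have [n n0n len] := walk_law_equidistributed image_law_ge0 sum_image_law
  image_law0_gt0 image_law_generates n0 e_gt0.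
by exists n => // k; rewrite proj_walk_law lee_fin.
Qed.

(** At arbitrarily late times the projection gives each point of [U] a mass of
    almost [1 / #|K|], so every supremum over a tail is at least
    [#|U| / #|K|]. *)
Lemma limsup_walk_ge (U : {set K}) (C : set G) :
    (forall g, proj g \in U -> C g) ->
  ((#|U|%:R / #|K|%:R)%:E <=
     limn_esup (fun n => P [set w | C (walk x n w)]))%E.
Proof.
move=> UC; rewrite limn_esup_lim; apply: lime_ge; first exact: is_cvg_esups.
apply: nearW => n0; apply/lee_addgt0Pr => e e_gt0.
have U1_gt0 : 0 < #|U|%:R + 1 :> R by rewrite ltr_wpDl.
(* An error [e / (#|U| + 1)] per point adds up to at most [e] over [U]; the
   successor covers empty [U]. *)
have [n n0n len] := proj_walk_equidistributed n0 (divr_gt0 e_gt0 U1_gt0).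
have mU : measurable [set w | proj (walk x n w) \in U].
  exact: (measurable_walk n [set g | proj g \in U]).
have PU : ((#|U|%:R / #|K|%:R - e)%:E <= P [set w | C (walk x n w)])%E.
  apply: (@le_trans _ _ (P [set w | proj (walk x n w) \in U])); last first.
    by apply: le_measure; rewrite ?inE; [exact: mU|exact: measurable_walk
      |move=> w /=; exact: UC].
  rewrite (@measure_fibres _ _ _ P _ (fun w => proj (walk x n w))); last first.
    move=> k; apply: measurableI; first exact: mU.
    exact: (measurable_walk n [set g | proj g = k]).
  apply: (@le_trans _ _ (\sum_(k in U) P [set w | proj (walk x n w) = k]))%E.
    apply: le_trans (lee_sum _ (fun k _ => len k)).
    rewrite sumEFin lee_fin sumr_const -[leRHS]mulr_natl mulrBr lerD2l lerN2.
    rewrite mulrA ler_pdivrMr // mulrC ler_wpM2l ?ltW //; lra.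
  rewrite [leLHS]big_mkcond /=; apply: lee_sum => k _; case: ifPn => kU.
    rewrite (_ : _ `&` _ = [set w | proj (walk x n w) = k]) //.
    by apply/seteqP; split=> w /= [] // ->.
  exact: measure_ge0.
rewrite -leeBlDr //; apply: le_trans PU _.
by apply: ereal_sup_ubound; exists n.
Qed.

End ProjectedWalk.

(** * The power law in the semidirect product *)

Section SemidirectPowerLaw.
Variables (n m : nat) (A : 'M[int]_n).
Hypotheses (m_gt1 : (1 < m)%N) (Am1 : A ^+ m = 1%:M).
Local Notation G := (semidirect m_gt1 Am1).

Lemma sd_snd_expg (g : G) p : (g ^+ p)%g.2 = g.2 *+ p.
Proof. by elim: p => [|p IH]; rewrite ?expg0 // expgS mulrS -IH. Qed.

Lemma Zp_mulrn_modulus (k : 'Z_m) : k *+ m = 0.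
Proof. by rewrite -mulr_natr pchar_Zp // mulr0. Qed.

Lemma sd_translation_expg (v : 'cV[int]_n) p :
  (((v, 0) : G) ^+ p)%g = (v *+ p, 0) :> G.
Proof.
elim: p => [|p IH]; first by rewrite expg0 mulr0n.
by rewrite expgS IH; congr pair; rewrite /= ?expr0 ?mul1mx ?mulrS ?addr0.
Qed.

Lemma fixed_expr_mul (w : 'cV[int]_n) j p :
  A ^+ j *m w = w -> A ^+ (j * p) *m w = w.
Proof.
move=> Aw; elim: p => [|p IH]; first by rewrite muln0 expr0 mul1mx.
by rewrite mulnS exprD -mulmxA IH.
Qed.

(** By Bezout and [A ^+ m = 1], [A] is a power of [A ^+ j]. *)
Lemma fixed_expr_coprime (w : 'cV[int]_n) j :
  coprime m j -> A ^+ j *m w = w -> A *m w = w.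
Proof.
move=> m_j Aw; have j_gt0 : (0 < j)%N.
  case: j m_j {Aw} => //; rewrite /coprime gcdn0 => /eqP m1.
  by move: m_gt1; rewrite m1.
have [a b ab _] := egcdnP m j_gt0.
have := fixed_expr_mul a Aw.
rewrite [(j * a)%N]mulnC ab -[gcdn _ _]gcdnC (eqP m_j) exprD expr1 mulnC exprM.
by rewrite Am1 expr1n mul1r.
Qed.

Hypothesis detA : \det (A - 1%:M) != 0.

Lemma fixed_eq0 (w : 'cV[int]_n) : A *m w = w -> w = 0.
Proof.
move=> Aw; have : \det (A - 1%:M) *: w = 0.
  rewrite -mul_scalar_mx -mul_adj_mx -mulmxA mulmxBl Aw mul1mx subrr.
  by rewrite mulmx0.
by move/eqP; rewrite scalemx_eq0 (negPf detA) => /eqP.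
Qed.

(** An [m]-th power is a translation [(w, 0)], and it commutes with its base
    [g = (v, k)]; comparing the two products gives [A ^+ k *m w = w]. *)
Lemma sd_expg_coprime (g : G) : coprime m g.2 -> (g ^+ m = 1)%g.
Proof.
move=> m_g; have := commuteX m (erefl : commute g g).
have := sd_snd_expg g m; rewrite Zp_mulrn_modulus.
case: (g ^+ m)%g => w z /= ->.
move=> /(congr1 fst) /=; rewrite expr0 mul1mx addrC => /addIr.
by move/(fixed_expr_coprime m_g)/fixed_eq0 ->.
Qed.
End SemidirectPowerLaw.

Lemma card_coprime_Zp m (m_gt1 : (1 < m)%N) :
  #|[set k : 'Z_m | coprime m k]%SET| = totient m.
Proof.
rewrite totient_count_coprime -sum1_card big_mkcond /=.
rewrite -[X in (\sum_(0 <= d < X) _)%N](Zp_cast m_gt1) big_mkord.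
by apply: eq_bigr => k _; rewrite finset.in_set; case: coprime.
Qed.

(** By the pigeonhole principle two distinct multiples of a nonzero
    translation lie in the same coset of a finite-index subgroup, which thus
    contains a translation of infinite order. *)
Lemma not_virtually_power_law m p (m_gt1 : (1 < m)%N) (A : 'M[int]_p.+1)
    (Am1 : A ^+ m = 1%:M) :
  ~ virtually (@satisfies_power_law (semidirect m_gt1 Am1) m).
Proof.
move=> [H [[H1 HV] H_fin H_pow]].
pose t (i : nat) : semidirect m_gt1 Am1 := (const_mx 1 *+ i, 0).
pose c i := [set (t i * h)%g | h in H].
have c_inj : injective c.
  move=> i j ij.
  have [h Hh tij] : c j (t i).
    by rewrite -ij; exists 1%g; rewrite ?mulg1 //; apply/set_mem.
  have /(congr1 fst) := H_pow _ Hh.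
  have -> : h = ((const_mx 1 *+ i - const_mx 1 *+ j, 0) : semidirect m_gt1 Am1).
    apply: (mulgI (t j)); rewrite tij; congr pair; last by rewrite /= addr0.
    by rewrite /= expr0 mul1mx addrC subrK.
  rewrite sd_translation_expg /= => /matrixP/(_ 0 0).
  rewrite !(mulmxnE, mxE) => /eqP.
  rewrite mulrn_eq0 => /orP[|].
    by move: (m_gt1); case: (m).
  by rewrite subr_eq0 => /eqP; rewrite !pmulrn !intz => -[].
apply: infinite_nat.
have -> : [set: nat] =
    c @^-1` [set [set (g * h)%g | h in H] | g in [set: semidirect m_gt1 Am1]].
  by apply/seteqP; split=> // i _; exists (t i).
by apply: finite_preimage => // i j _ _; exact: c_inj.
Qed.

Theorem proposition5p13 (m : nat) (m_gt1 : (1 < m)%N) (A : 'M[int]_(m.-1))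
    (Am1 : A ^+ m = 1%:M) (detA : \det (A - 1%:M) != 0) :
  let G : groupType := semidirect m_gt1 Am1 in
  (forall (R : realType) (mu : probability (discr G) R),
     lazy_step mu ->
   forall (d : measure_display) (Omega : measurableType d)
     (P : probability Omega R) (x : nat -> {RV P >-> discr G}),
     iid_of_law mu x ->
     (((totient m)%:R / m%:R)%:E <=
        limn_esup (fun n => P [set w | (walk x n w ^+ m = 1)%g]))%E)
  /\ ~ virtually (@satisfies_power_law G m).
Proof.
move=> G; split=> [R mu mu_lazy d Omega P x x_iid|]; last first.
  have m1_gt0 : (0 < m.-1)%N by rewrite -ltnS prednK // ltnW.
  rewrite /G; move: (m.-1) m1_gt0 A Am1 {detA G} => [//|p] _ A Am1.
  exact: not_virtually_power_law.
pose proj (g : G) : 'Z_m := g.2.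
pose U : {set 'Z_m} := [set k : 'Z_m | coprime m k]%SET.
have projM (g h : G) : proj (g * h)%g = proj g + proj h by [].
have proj_surj (k : 'Z_m) : exists g : G, proj g = k by exists (0, k).
have G_countable : countable [set: G].
  exact: (@countableP ('cV[int]_(m.-1) * 'Z_m)%type).
have U_pow (g : G) : proj g \in U -> [set g : G | (g ^+ m = 1)%g] g.
  by rewrite finset.in_set; exact: sd_expg_coprime.
have := limsup_walk_ge projM proj_surj mu_lazy G_countable x_iid U_pow.
by rewrite card_coprime_Zp // card_ord Zp_cast.
Qed.
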